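(* Let $\mathbb{F}$ be a field and let $(\mathsf{Zin},\mu,\eta)$ be the free Zinbiel algebra monad on the category $\mathbb{F}\text{-}\mathsf{VEC}$ of $\mathbb{F}$-vector spaces. Then the linear maps $\partial_V:\mathsf{Zin}(V)\to\mathsf{Zin}(V\times V)$ given on pure tensors by $$\partial_V(v_1\otimes v_2\otimes\cdots\otimes v_n)=(0,v_1)\otimes(v_2,0)\otimes\cdots\otimes(v_n,0)$$ form a differential combinator transformation for the monad $(\mathsf{Zin},\mu,\eta)$.
   Context: The monad $\mathsf{Zin}$. A Zinbiel algebra over $\mathbb{F}$ is an $\mathbb{F}$-vector space $A$ with a bilinear operation $<$ satisfying $(a<b)<c=a<(b<c)+a<(c<b)$. For an $\mathbb{F}$-vector space $V$, $\mathsf{Zin}(V)=\bigoplus_{n\ge1}V^{\otimes n}$, the free Zinbiel algebra on $V$, with product given on pure tensors by $$(v_1\otimes\cdots\otimes v_n)<(w_1\otimes\cdots\otimes w_m)=\sum_{\sigma}v_1\otimes\sigma\cdot(v_2\otimes\cdots\otimes v_n\otimes w_1\otimes\cdots\otimes w_m),$$ where $\sigma$ runs over the $(n-1,m)$-shuffles (representatives of $S(n+m-1)/(S(n-1)\times S(m))$), i.e. the sum is over all interleavings of the words $v_2\cdots v_n$ and $w_1\cdots w_m$ preserving the internal order of each word; the product is extended bilinearly. For linear $f:V\to W$, $\mathsf{Zin}(f)(v_1\otimes\cdots\otimes v_n)=f(v_1)\otimes\cdots\otimes f(v_n)$. The unit is the inclusion $\eta_V(v)=v$. The multiplication $\mu_V:\mathsf{Zin}\mathsf{Zin}(V)\to\mathsf{Zin}(V)$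 is the linear map with $\mu_V(\mathfrak{v}_1\otimes\cdots\otimes\mathfrak{v}_n)=\mathfrak{v}_1<(\cdots(\mathfrak{v}_{n-1}<\mathfrak{v}_n)\cdots)$ for $\mathfrak{v}_1,\dots,\mathfrak{v}_n\in\mathsf{Zin}(V)$. It is known that $(\mathsf{Zin},\mu,\eta)$ is a monad on $\mathbb{F}\text{-}\mathsf{VEC}$. Differential combinator transformations on monads. Let $(\mathsf{S},\mu,\eta)$ be a monad on a category with finite biproducts $\times$, with projections $\pi_0,\pi_1$, injections $\iota_0,\iota_1$, diagonal $\Delta_V=\langle 1_V,1_V\rangle:V\to V\times V$, and copairing $[-,-]$. Let $c_V=\langle\pi_0\times\pi_0,\pi_1\times\pi_1\rangle:(V\times V)\times(V\times V)\to(V\times V)\times(V\times V)$. A differential combinator transformation on $(\mathsf{S},\mu,\eta)$ is a natural transformation $\partial_V:\mathsf{S}(V)\to\mathsf{S}(V\times V)$ such that: [dc.1] $\mathsf{S}(\pi_0)\circ\partial_V=0$; [dc.2] $\mathsf{S}(1_V\times\Delta_V)\circ\partial_V=(\mathsf{S}(1_V\times\iota_0)+\mathsf{S}(1_V\times\iota_1))\circ\partial_V$; [dc.3] $\partial_V\circ\eta_V=\eta_{V\times V}\circ\iota_1$; [dc.4] $\partial_V\circ\mu_V=\mu_{V\times V}\circ\mathsf{S}([\mathsf{S}(\iota_0),\partial_V])\circ\partial_{\mathsf{S}(V)}$; [dc.5] $\mathsf{S}(\pi_0\times\pi_1)\circ\partial_{V\times V}\circ\partial_V=\partial_V$; [dc.6]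 $\mathsf{S}(c_V)\circ\partial_{V\times V}\circ\partial_V=\partial_{V\times V}\circ\partial_V$. (This is the dual of the notion of differential combinator transformation on a comonad.) *)

(* Defs.v *)
From HB Require Import structures.
From mathcomp Require Import all_boot all_algebra.
From mathcomp Require Import finmap.
From mathcomp Require Import boolp.
From mathcomp Require Import xfinmap monalg.

Set Implicit Arguments.
Unset Strict Implicit.
Unset Printing Implicit Defensive.

Import GRing.Theory BigEnoughFSet.
Local Open Scope ring_scope.
Local Open Scope quotient_scope.

Definition linear_map (F : fieldType) (V W : lmodType F) (f : V -> W)
  (fL : linear f) : {linear V -> W} :=
  HB.pack f (GRing.isLinear.Build F V W *:%R f fL).

(** * Quotients of vector spaces *)

Section Quotient.
Variables (F : fieldType) (M : lmodType F).

Inductive spanned (G : M -> Prop) : M -> Prop :=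
| Spanned0 : spanned G 0
| SpannedS a x y : G x -> spanned G y -> spanned G (a *: x + y).

Definition span (G : M -> Prop) : pred M := fun x => `[< spanned G x >].

Lemma span_submod_closed (G : M -> Prop) : submod_closed (span G).
Proof.
split=> [|a x y /asboolP Gx /asboolP Gy]; first exact/asboolP/Spanned0.
apply/asboolP; elim: Gx => [|b u v Gu _ IHv]; first by rewrite scaler0 add0r.
by rewrite scalerDr scalerA -addrA; apply: SpannedS.
Qed.

HB.instance Definition _ (G : M -> Prop) :=
  GRing.isSubmodClosed.Build F M (span G) (span_submod_closed G).

HB.instance Definition _ (G : M -> Prop) :=
  GRing.isZmodClosed.Build M (span G) (GRing.submod_closedB (span_submod_closed G)).

Variable G : M -> Prop.
Local Notation I := (GRing.ZmodClosed.clone M (span G) _).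

Definition lquot := Quotient.quot I.
HB.instance Definition _ := GRing.Zmodule.on lquot.

Definition lquot_pi (x : M) : lquot := \pi_(Quotient.quot I) x.

Lemma lquot_eq x y : (lquot_pi x = lquot_pi y) <-> (x - y \in I).
Proof. by rewrite Quotient.idealrBE; split=> /eqP. Qed.

Definition lquot_scale (a : F) (q : lquot) : lquot :=
  lquot_pi (a *: repr (q : Quotient.quot I)).

Lemma lquot_reprK (q : lquot) : lquot_pi (repr (q : Quotient.quot I)) = q.
Proof. exact: reprK. Qed.

Lemma lquot_piD x y : lquot_pi (x + y) = lquot_pi x + lquot_pi y.
Proof. exact: (raddfD (\pi_(Quotient.quot I))). Qed.

Lemma lquot_scale_pi a x : lquot_scale a (lquot_pi x) = lquot_pi (a *: x).
Proof. by apply/lquot_eq; rewrite -scalerBr rpredZ //; apply/lquot_eq/lquot_reprK. Qed.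

Lemma lquot_scaleA a b q : lquot_scale a (lquot_scale b q) = lquot_scale (a * b) q.
Proof. by rewrite -[q]lquot_reprK !lquot_scale_pi scalerA. Qed.

Lemma lquot_scale1 : left_id 1 lquot_scale.
Proof. by move=> q; rewrite -[q]lquot_reprK !lquot_scale_pi scale1r. Qed.

Lemma lquot_scaleDr : right_distributive lquot_scale +%R.
Proof.
move=> a p q; rewrite -[p]lquot_reprK -[q]lquot_reprK.
by rewrite -lquot_piD !lquot_scale_pi -lquot_piD scalerDr.
Qed.

Lemma lquot_scaleDl q : {morph lquot_scale^~ q : a b / a + b}.
Proof.
by move=> a b; rewrite -[q]lquot_reprK !lquot_scale_pi -lquot_piD scalerDl.
Qed.

HB.instance Definition _ := GRing.Zmodule_isLmodule.Build F lquot
  lquot_scaleA lquot_scale1 lquot_scaleDr lquot_scaleDl.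

Lemma lquot_pi_linear : linear lquot_pi.
Proof. by move=> a x y; rewrite lquot_piD -lquot_scale_pi. Qed.

HB.instance Definition _ := GRing.isLinear.Build F M lquot *:%R lquot_pi
  lquot_pi_linear.

Section Lift.
Variables (W : lmodType F) (f : {linear M -> W}).
Definition lquot_lift (q : lquot) : W := f (repr (q : Quotient.quot I)).
Hypothesis fG : forall x, G x -> f x = 0.
Lemma lquot_kills x : x \in I -> f x = 0.
Proof.
move=> /asboolP; elim=> [|a r r' Gr _ IH]; first exact: linear0.
by rewrite linearP IH addr0 fG // scaler0.
Qed.
Lemma lquot_liftE x : lquot_lift (lquot_pi x) = f x.
Proof.
apply/eqP; rewrite -subr_eq0 -linearB; apply/eqP/lquot_kills.
exact/lquot_eq/lquot_reprK.
Qed.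
Lemma lquot_lift_linear : linear lquot_lift.
Proof.
move=> a p q; rewrite -[p]lquot_reprK -[q]lquot_reprK -linearP.
by rewrite !lquot_liftE linearP.
Qed.
End Lift.
End Quotient.

(** * Free vector spaces *)

Section Free.
Variables (F : fieldType) (K : choiceType) (W : lmodType F) (phi : K -> W).

Definition free_lift (g : {malg F[K]}) : W := \sum_(k <- msupp g) g@_k *: phi k.

Lemma free_liftEw (d : {fset K}) g : (msupp g `<=` d)%fset ->
  free_lift g = \sum_(k <- d) g@_k *: phi k.
Proof.
move=> le; rewrite [LHS](big_fset_incl _ le) => //= x xd /mcoeff_outdom ->.
by rewrite scale0r.
Qed.

Lemma free_lift_linear : linear free_lift.
Proof.
move=> a g1 g2; pose d := (msupp g1 `|` msupp g2)%fset.
have le1 : (msupp g1 `<=` d)%fset by apply: fsubsetUl.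
have le2 : (msupp g2 `<=` d)%fset by apply: fsubsetUr.
have le : (msupp (a *: g1 + g2) `<=` d)%fset.
  apply: fsubset_trans (msuppD_le _ _) _.
  by apply: fsetSU; apply: msuppZ_le.
rewrite (free_liftEw le) (free_liftEw le1) (free_liftEw le2).
rewrite scaler_sumr -big_split; apply: eq_bigr => k _ /=.
by rewrite mcoeffD mcoeffZ scalerDl scalerA.
Qed.

HB.instance Definition _ := GRing.isLinear.Build F {malg F[K]} W *:%R free_lift
  free_lift_linear.

Lemma free_liftU k : free_lift << k >> = phi k.
Proof. by rewrite (free_liftEw msuppU_le) big_seq_fset1 mcoeffUU scale1r. Qed.

Lemma free_ext (f g : {linear {malg F[K]} -> W}) :
  (forall k, f << k >> = g << k >>) -> f =1 g.
Proof.
move=> fg x; rewrite (monalgE x) !linear_sum; apply: eq_bigr => k _.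
have -> : << x@_k *g k >> = x@_k *: << k >> :> {malg F[K]}.
  by apply/malgP => k'; rewrite mcoeffZ !mcoeffU mulrnAr mulr1.
by rewrite !linearZ fg.
Qed.
End Free.

(** * Tensor powers *)

Section Tensor.
Variables (F : fieldType) (V : lmodType F).

Definition multilinear (W : lmodType F) (phi : seq V -> W) : Prop :=
  forall (a : F) (x y : V) (s t : seq V),
    phi (s ++ (a *: x + y) :: t) = a *: phi (s ++ x :: t) + phi (s ++ y :: t).

Definition tensor_rel (n : nat) (r : {malg F[n.-tuple V]}) : Prop :=
  exists (a : F) (x y : V) (s t : seq V) (u v w : n.-tuple V),
    [/\ u = s ++ (a *: x + y) :: t :> seq V,
        v = s ++ x :: t :> seq V,
        w = s ++ y :: t :> seq V &
        r = << u >> - (a *: << v >> + << w >>)].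

Definition tpow (n : nat) : lmodType F := lquot (@tensor_rel n).

Definition tens (n : nat) (t : n.-tuple V) : tpow n :=
  lquot_pi (@tensor_rel n) << t >>.

Section Lift.
Variables (n : nat) (W : lmodType F) (phi : seq V -> W).
Definition tpow_lift (q : tpow n) : W :=
  lquot_lift (free_lift (fun t : n.-tuple V => phi t)) q.
Hypothesis phiM : multilinear phi.
Lemma tpow_lift_kills x : @tensor_rel n x ->
  free_lift (fun t : n.-tuple V => phi t) x = 0.
Proof.
case=> b [x1 [y1 [s [t [t0 [t1 [t2 [e0 e1 e2 ->]]]]]]]].
by rewrite linearB /= free_lift_linear !free_liftU e0 e1 e2 phiM subrr.
Qed.
Lemma tpow_liftE t : tpow_lift (tens t) = phi t.
Proof.
by rewrite /tpow_lift lquot_liftE; [exact: free_liftU | exact: tpow_lift_kills].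
Qed.
Lemma tpow_lift_linear : linear tpow_lift.
Proof. exact/lquot_lift_linear/tpow_lift_kills. Qed.
End Lift.

Lemma tpow_ext n (W : lmodType F) (f g : {linear tpow n -> W}) :
  (forall t, f (tens t) = g (tens t)) -> f =1 g.
Proof.
move=> fg q; rewrite -[q]lquot_reprK; move: (repr _).
exact: (@free_ext _ _ _ (f \o lquot_pi _)%FUN (g \o lquot_pi _)%FUN fg).
Qed.

End Tensor.

(** * Direct sums *)

Section DirectSum.
Variables (F : fieldType) (M : nat -> lmodType F).

Record dsum := DSum {
  dcoef :> forall n, M n;
  dsum_fin : exists N, forall n, (N <= n)%N -> dcoef n = 0 }.

HB.instance Definition _ := gen_eqMixin dsum.
HB.instance Definition _ := gen_choiceMixin dsum.

Lemma dsumP (x y : dsum) : (forall n, x n = y n) -> x = y.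
Proof.
case: x y => [f fP] [g gP] /= fg.
have e : f = g by exact: functional_extensionality_dep.
by case: _ / e gP => gP; congr DSum; apply: Prop_irrelevance.
Qed.

Fact dsum_zero_fin : exists N, forall n, (N <= n)%N -> (0 : M n) = 0.
Proof. by exists 0%N. Qed.
Definition dsum_zero := DSum dsum_zero_fin.

Fact dsum_opp_fin (x : dsum) : exists N, forall n, (N <= n)%N -> - x n = 0.
Proof. by have [N xN] := dsum_fin x; exists N => n /xN ->; rewrite oppr0. Qed.
Definition dsum_opp x := DSum (dsum_opp_fin x).

Fact dsum_add_fin (x y : dsum) :
  exists N, forall n, (N <= n)%N -> x n + y n = 0.
Proof.
have [[N xN] [P yP]] := (dsum_fin x, dsum_fin y).
by exists (maxn N P) => n; rewrite geq_max => /andP[/xN -> /yP ->]; rewrite addr0.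
Qed.
Definition dsum_add x y := DSum (dsum_add_fin x y).

Fact dsum_scale_fin a (x : dsum) : exists N, forall n, (N <= n)%N -> a *: x n = 0.
Proof. by have [N xN] := dsum_fin x; exists N => n /xN ->; rewrite scaler0. Qed.
Definition dsum_scale a x := DSum (dsum_scale_fin a x).

Fact dsum_addA : associative dsum_add.
Proof. by move=> x y z; apply: dsumP => n /=; rewrite addrA. Qed.
Fact dsum_addC : commutative dsum_add.
Proof. by move=> x y; apply: dsumP => n /=; rewrite addrC. Qed.
Fact dsum_add0 : left_id dsum_zero dsum_add.
Proof. by move=> x; apply: dsumP => n /=; rewrite add0r. Qed.
Fact dsum_addN : left_inverse dsum_zero dsum_opp dsum_add.
Proof. by move=> x; apply: dsumP => n /=; rewrite addNr. Qed.

HB.instance Definition _ :=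
  GRing.isZmodule.Build dsum dsum_addA dsum_addC dsum_add0 dsum_addN.

Fact dsum_scaleA a b x : dsum_scale a (dsum_scale b x) = dsum_scale (a * b) x.
Proof. by apply: dsumP => n /=; rewrite scalerA. Qed.
Fact dsum_scale1 : left_id 1 dsum_scale.
Proof. by move=> x; apply: dsumP => n /=; rewrite scale1r. Qed.
Fact dsum_scaleDr : right_distributive dsum_scale +%R.
Proof. by move=> a x y; apply: dsumP => n /=; rewrite scalerDr. Qed.
Fact dsum_scaleDl x : {morph dsum_scale^~ x : a b / a + b}.
Proof. by move=> a b; apply: dsumP => n /=; rewrite scalerDl. Qed.

HB.instance Definition _ := GRing.Zmodule_isLmodule.Build F dsum
  dsum_scaleA dsum_scale1 dsum_scaleDr dsum_scaleDl.

Lemma dsumDE (x y : dsum) n : (x + y) n = x n + y n. Proof. by []. Qed.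
Lemma dsumZE a (x : dsum) n : (a *: x) n = a *: x n. Proof. by []. Qed.

Definition dsum_in_coef n (v : M n) (m : nat) : M m :=
  if n =P m is ReflectT e then ecast k (M k) e v else 0.

Lemma dsum_in_coef_eq n v : @dsum_in_coef n v n = v.
Proof. by rewrite /dsum_in_coef; case: eqP => // e; rewrite eq_axiomK. Qed.

Lemma dsum_in_coef_neq n v m : n != m -> @dsum_in_coef n v m = 0.
Proof. by rewrite /dsum_in_coef; case: eqP. Qed.

Fact dsum_in_fin n (v : M n) :
  exists N, forall m, (N <= m)%N -> dsum_in_coef v m = 0.
Proof. by exists n.+1 => m lt_nm; rewrite dsum_in_coef_neq ?ltn_eqF. Qed.

Definition dsum_in n (v : M n) : dsum := DSum (dsum_in_fin v).

Lemma dsum_in_linear n : linear (@dsum_in n).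
Proof.
move=> a x y; apply: dsumP => m; rewrite dsumDE dsumZE /=.
have [<-|nm] := eqVneq n m; first by rewrite !dsum_in_coef_eq.
by rewrite !dsum_in_coef_neq // scaler0 addr0.
Qed.

HB.instance Definition _ n :=
  GRing.isLinear.Build F (M n) dsum *:%R (@dsum_in n) (@dsum_in_linear n).

Lemma dsum_sum (x : dsum) N : (forall n, (N <= n)%N -> x n = 0) ->
  x = \sum_(n < N) dsum_in (x n).
Proof.
move=> xN; apply: dsumP => m.
have coefD : {morph (fun y : dsum => y m) : y z / y + z} by [].
rewrite (big_morph _ coefD (erefl _)) /=.
have [lt_mN|le_Nm] := ltnP m N.
  rewrite (bigD1 (Ordinal lt_mN)) //= dsum_in_coef_eq big1 ?addr0 // => i.
  by rewrite -val_eqE /= => im; rewrite dsum_in_coef_neq.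
rewrite xN // big1 // => i _; rewrite dsum_in_coef_neq //.
by rewrite ltn_eqF // (leq_trans (ltn_ord i)).
Qed.

Section Lift.
Variables (W : lmodType F) (g : forall n, M n -> W).

Definition dsum_lift (x : dsum) : W :=
  \sum_(n < projT1 (cid (dsum_fin x))) g (x n).

Hypothesis g_linear : forall n, linear (@g n).

Let g0 n : g (0 : M n) = 0.
Proof.
by have := @g_linear n (-1) 0 0; rewrite scaler0 addr0 scaleN1r addNr.
Qed.

Lemma dsum_liftEw (x : dsum) N : (forall n, (N <= n)%N -> x n = 0) ->
  dsum_lift x = \sum_(n < N) g (x n).
Proof.
rewrite /dsum_lift; case: (cid _) => P /= xP xN.
wlog le : N P xP xN / (P <= N)%N.
  by move=> h; case/orP: (leq_total P N) => le; [|symmetry]; apply: h le.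
rewrite (big_ord_widen N (fun n => g (x n))) // [RHS](bigID (fun i : 'I_N => (i < P)%N)) /=.
by rewrite [X in _ + X]big1 ?addr0 // => i; rewrite -leqNgt => /xP ->; apply: g0.
Qed.

Lemma dsum_lift_linear : linear dsum_lift.
Proof.
move=> a x y; have [[N xN] [P yP]] := (dsum_fin x, dsum_fin y).
have leN n : (maxn N P <= n)%N -> x n = 0.
  by rewrite geq_max => /andP[/xN].
have leP n : (maxn N P <= n)%N -> y n = 0.
  by rewrite geq_max => /andP[_ /yP].
rewrite (dsum_liftEw leN) (dsum_liftEw leP) (@dsum_liftEw _ (maxn N P)); last first.
  by move=> n le; rewrite dsumDE dsumZE leN // leP // scaler0 addr0.
by rewrite scaler_sumr -big_split; apply: eq_bigr => n _ /=; rewrite -g_linear.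
Qed.

Lemma dsum_liftE n (v : M n) : dsum_lift (dsum_in v) = g v.
Proof.
rewrite (@dsum_liftEw _ n.+1) => [|m lt_nm]; last first.
  by rewrite /= dsum_in_coef_neq ?ltn_eqF.
rewrite big_ord_recr /= dsum_in_coef_eq big1 ?add0r // => i _.
by rewrite dsum_in_coef_neq // eq_sym ltn_eqF.
Qed.
End Lift.

Lemma dsum_ext (W : lmodType F) (f g : {linear dsum -> W}) :
  (forall n (v : M n), f (dsum_in v) = g (dsum_in v)) -> f =1 g.
Proof.
move=> fg x; have [N /dsum_sum ->] := dsum_fin x.
by rewrite !linear_sum; apply: eq_bigr => n _; apply: fg.
Qed.

End DirectSum.

(** * The free Zinbiel algebra *)

Definition Zin (F : fieldType) (V : lmodType F) : lmodType F :=
  dsum (fun n => tpow V n.+1).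

HB.lock Definition word (F : fieldType) (V : lmodType F) (s : seq V) : Zin V :=
  if s is v :: s' then
    dsum_in (M := fun n => tpow V n.+1) (tens (in_tuple (v :: s')))
  else 0.

HB.lock Definition zin_lift (F : fieldType) (V W : lmodType F)
    (phi : seq V -> W) (x : Zin V) : W :=
  dsum_lift (fun n => @tpow_lift F V n.+1 W phi) x.

Arguments word {F V} s.
Arguments zin_lift {F V W} phi x.

Section Zin.
Variables (F : fieldType) (V : lmodType F).

Section Lift.
Variables (W : lmodType F) (phi : seq V -> W).
Hypothesis phiM : multilinear phi.

Lemma zin_lift_linear : linear (zin_lift phi).
Proof.
rewrite zin_lift.unlock; apply: dsum_lift_linear => n.
exact: tpow_lift_linear.
Qed.

Lemma zin_liftE v s : zin_lift phi (word (v :: s)) = phi (v :: s).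
Proof.
rewrite zin_lift.unlock word.unlock dsum_liftE; last first.
  by move=> n; apply: tpow_lift_linear.
exact: tpow_liftE.
Qed.
End Lift.

Lemma word_tuple n (u : n.+1.-tuple V) :
  word u = dsum_in (M := fun n => tpow V n.+1) (tens u).
Proof.
rewrite word.unlock; case: u => [[|v s] // sz] /=; have e : size s = n by exact/eqP.
case: n / e sz => sz.
by have <- : in_tuple (v :: s) = Tuple sz by apply: val_inj.
Qed.

Lemma zin_ext (W : lmodType F) (f g : {linear Zin V -> W}) :
  (forall v s, f (word (v :: s)) = g (word (v :: s))) -> f =1 g.
Proof.
pose M n := tpow V n.+1.
move=> fg; apply: dsum_ext => n.
have fl : linear (fun v : tpow V n.+1 => f (@dsum_in F M n v)).
  by move=> a x y; rewrite !linearP.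
have gl : linear (fun v : tpow V n.+1 => g (@dsum_in F M n v)).
  by move=> a x y; rewrite !linearP.
apply: (@tpow_ext _ _ _ _ (linear_map fl) (linear_map gl)) => t /=.
have := word_tuple t; rewrite /M => <-.
by case: t => [[|v s] // sz]; apply: fg.
Qed.

Lemma word_multilinear : multilinear (@word F V).
Proof.
move=> a x y s t; pose n := (size s + size t)%N.
have sz z : size (s ++ z :: t) == n.+1 by rewrite size_cat /= addnS.
rewrite (word_tuple (Tuple (sz (a *: x + y)))) (word_tuple (Tuple (sz x))).
rewrite (word_tuple (Tuple (sz y))) -linearP; congr dsum_in.
rewrite /tens -linearP; apply/lquot_eq/asboolP.
rewrite -[_ - _]addr0 -[_ - _]scale1r.
apply: SpannedS (Spanned0 _); exists a, x, y, s, t.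
by exists (Tuple (sz (a *: x + y))), (Tuple (sz x)), (Tuple (sz y)).
Qed.
End Zin.



Lemma multilinear_comp (F : fieldType) (V W U : lmodType F) (f : {linear V -> W})
  (phi : seq W -> U) : multilinear phi -> multilinear (fun s => phi (map f s)).
Proof. by move=> phiM a x y s t; rewrite !map_cat /= linearP phiM. Qed.

(** * Shuffles and the Zinbiel product *)

Fixpoint shuffle (T : Type) (s : seq T) : seq T -> seq (seq T) :=
  if s is x :: s' then
    fix shuffle_s (t : seq T) : seq (seq T) :=
      if t is y :: t' then
        map (cons x) (shuffle s' t) ++ map (cons y) (shuffle_s t')
      else [:: s]
  else fun t => [:: t].

Section ShuffleSum.
Variables (F : fieldType) (V W : lmodType F).
Implicit Types (phi : seq V -> W) (s t u : seq V).

Definition shuffle_sum phi s t : W := \sum_(r <- shuffle s t) phi r.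

Lemma shuffle_sum0s phi t : shuffle_sum phi [::] t = phi t.
Proof. by rewrite /shuffle_sum /= big_seq1. Qed.

Lemma shuffle_sums0 phi s : shuffle_sum phi s [::] = phi s.
Proof. by case: s => [|x s]; rewrite /shuffle_sum /= big_seq1. Qed.

Lemma shuffle_sum_cons phi x s y t : shuffle_sum phi (x :: s) (y :: t) =
  shuffle_sum (phi \o cons x) s (y :: t) + shuffle_sum (phi \o cons y) (x :: s) t.
Proof. by rewrite /shuffle_sum /= big_cat !big_map. Qed.

Lemma shuffle_sumC phi s t : shuffle_sum phi s t = shuffle_sum phi t s.
Proof.
elim: s t phi => [|x s IHs] t phi; first by rewrite shuffle_sum0s shuffle_sums0.
elim: t phi => [|y t IHt] phi; first by rewrite shuffle_sum0s shuffle_sums0.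
by rewrite !shuffle_sum_cons IHs IHt addrC.
Qed.

Lemma shuffle_sumD phi psi s t :
  shuffle_sum (phi \+ psi) s t = shuffle_sum phi s t + shuffle_sum psi s t.
Proof. exact: big_split. Qed.

Lemma shuffle_sumA phi s t u :
  shuffle_sum (fun r => shuffle_sum phi r u) s t =
  shuffle_sum (fun r => shuffle_sum phi s r) t u.
Proof.
elim: s t u phi => [|x s IHs] t u phi.
  by rewrite shuffle_sum0s; apply: eq_bigr => r _; rewrite shuffle_sum0s.
elim: t u phi => [|y t IHt] u phi; first by rewrite shuffle_sums0 shuffle_sum0s.
elim: u phi => [|z u IHu] phi.
  by rewrite shuffle_sums0; apply: eq_bigr => r _; rewrite shuffle_sums0.
have L w : (fun q => shuffle_sum phi q (z :: u)) \o cons w =1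
    (fun q => shuffle_sum (phi \o cons w) q (z :: u)) \+
    (fun q => shuffle_sum (phi \o cons z) (w :: q) u).
  by move=> q /=; rewrite shuffle_sum_cons.
have R w : (fun q => shuffle_sum phi (x :: s) q) \o cons w =1
    (fun q => shuffle_sum (phi \o cons x) s (w :: q)) \+
    (fun q => shuffle_sum (phi \o cons w) (x :: s) q).
  by move=> q /=; rewrite shuffle_sum_cons.
have eqs f g a b : f =1 g -> shuffle_sum f a b = shuffle_sum g a b.
  by move=> fg; apply: eq_bigr => q _; apply: fg.
rewrite !shuffle_sum_cons !(eqs _ _ _ _ (L _)) !(eqs _ _ _ _ (R _)).
rewrite !shuffle_sumD IHs IHt shuffle_sum_cons.
have:= IHu (phi \o cons z); rewrite shuffle_sum_cons => <-.
rewrite addrACA -!addrA; congr (_ + _).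
by rewrite addrCA.
Qed.

Lemma shuffle_sum_multilinear phi s : multilinear phi ->
  multilinear (shuffle_sum phi s).
Proof.
have consM (z : V) (psi : seq V -> W) : multilinear psi -> multilinear (psi \o cons z).
  by move=> psiM a x y p q /=; apply: (psiM _ _ _ (z :: p)).
elim: s phi => [|z s IHs] phi phiM a x y p q; first by rewrite !shuffle_sum0s.
elim: p phi phiM => [|w p IHp] phi phiM /=.
  rewrite !shuffle_sum_cons (IHs _ (consM z _ phiM) a x y [::]) /=.
  rewrite scalerDr addrACA; congr (_ + _).
  rewrite /shuffle_sum scaler_sumr -big_split; apply: eq_bigr => r _ /=.
  exact: (phiM a x y [::]).
rewrite !shuffle_sum_cons IHp; last exact: consM.
rewrite (IHs _ (consM z _ phiM) a x y (w :: p)) /=.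
by rewrite scalerDr addrACA.
Qed.
End ShuffleSum.

Section Product.
Variables (F : fieldType) (V : lmodType F).
Implicit Types (a b c : Zin V).

Definition word_mul (s t : seq V) : Zin V :=
  if s is v :: s' then \sum_(r <- shuffle s' t) word (v :: r) else 0.

Definition zin_mul a b : Zin V :=
  zin_lift (fun s => zin_lift (word_mul s) b) a.

Lemma word_consM v : multilinear (@word F V \o cons v).
Proof. by move=> a x y p q; apply: (word_multilinear _ _ _ (v :: p)). Qed.

Lemma word_mul_multilinear_r s : multilinear (word_mul s).
Proof.
case: s => [|v s] a x y p q; first by rewrite /= scaler0 addr0.
exact: (shuffle_sum_multilinear s (word_consM v) a x y p q).
Qed.

Lemma word_mul_multilinear_l t : multilinear (word_mul^~ t).
Proof.
move=> a x y [|v p] q /=.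
  rewrite scaler_sumr -big_split; apply: eq_bigr => r _ /=.
  exact: (word_multilinear _ _ _ [::]).
have := shuffle_sum_multilinear t (word_consM v) a x y p q.
by rewrite !(shuffle_sumC _ t).
Qed.

Let inner_linear s : linear (zin_lift (word_mul s)).
Proof. exact/zin_lift_linear/word_mul_multilinear_r. Qed.

Let outer_multilinear b :
  multilinear (fun s => zin_lift (word_mul s) b).
Proof.
move=> a x y p q.
pose f s := linear_map (inner_linear s).
have h : linear (fun c => a *: f (p ++ x :: q) c + f (p ++ y :: q) c).
  by move=> k c d; rewrite !linearP /= !scalerA mulrC -!addrA; congr (_ + _); rewrite addrCA.
apply: (zin_ext (f := f (p ++ (a *: x + y) :: q)) (g := linear_map h)) => v s /=.
by rewrite !zin_liftE //; [exact: word_mul_multilinear_l | exact: word_mul_multilinear_r..].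
Qed.

Lemma zin_mul_linear_l b : linear (zin_mul^~ b).
Proof. exact/zin_lift_linear/outer_multilinear. Qed.

Lemma zin_mul_word v s w t :
  zin_mul (word (v :: s)) (word (w :: t)) =
  \sum_(r <- shuffle s (w :: t)) word (v :: r).
Proof.
rewrite /zin_mul zin_liftE; last exact: outer_multilinear.
by rewrite zin_liftE //; apply: word_mul_multilinear_r.
Qed.

Lemma zin_mul_linear_r a : linear (zin_mul a).
Proof.
move=> k b c.
have h : linear (fun a => k *: zin_mul a b + zin_mul a c).
  by move=> l x y; rewrite !zin_mul_linear_l !scalerDr !scalerA mulrC addrACA.
apply: (zin_ext (f := linear_map (zin_mul_linear_l _)) (g := linear_map h)) => v s /=.
by rewrite /zin_mul !(zin_liftE (outer_multilinear _)); apply: inner_linear.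
Qed.

End Product.



Section ProductTheory.
Variables (F : fieldType) (V : lmodType F).
Implicit Types (a b c : Zin V).

Lemma zin_mul_sumr (I : Type) (r : seq I) a (f : I -> Zin V) :
  zin_mul a (\sum_(i <- r) f i) = \sum_(i <- r) zin_mul a (f i).
Proof. exact: (linear_sum (linear_map (zin_mul_linear_r a))). Qed.

Lemma zin_mul_suml (I : Type) (r : seq I) b (f : I -> Zin V) :
  zin_mul (\sum_(i <- r) f i) b = \sum_(i <- r) zin_mul (f i) b.
Proof. exact: (linear_sum (linear_map (zin_mul_linear_l b))). Qed.

Lemma zin_ind (P : Zin V -> Prop) :
  (forall (a : F) x y, P x -> P y -> P (a *: x + y)) ->
  (forall v s, P (word (v :: s))) -> forall x, P x.
Proof.
move=> PL Pw.
have P0 : P 0 by have := PL (-1) _ _ (Pw 0 [::]) (Pw 0 [::]); rewrite scaleN1r addNr.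
have PD x y : P x -> P y -> P (x + y) by move=> Px Py; rewrite -[x]scale1r; apply: PL.
have Psum (I : Type) (r : seq I) (f : I -> Zin V) :
    (forall i, P (f i)) -> P (\sum_(i <- r) f i).
  by move=> Pf; apply: big_ind.
move=> x; have [N /dsum_sum ->] := dsum_fin x.
apply: (Psum) => n; rewrite -[x n]lquot_reprK (monalgE (repr _)) !linear_sum.
apply: Psum => k; set g := repr _.
have -> : << g@_k *g k >> = g@_k *: << k >> :> {malg F[_]}.
  by apply/malgP => k'; rewrite mcoeffZ !mcoeffU mulrnAr mulr1.
rewrite !linearZ /= -[_ *: _]addr0; apply: PL P0.
rewrite -[lquot_pi _ _]/(tens k) -word_tuple.
by case: k => [[|v s] // sz]; apply: Pw.
Qed.

Lemma zin_mulA a b c :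
  zin_mul (zin_mul a b) c = zin_mul a (zin_mul b c) + zin_mul a (zin_mul c b).
Proof.
move: a b c; apply: zin_ind => [k x y IHx IHy b c|v s].
  by rewrite !zin_mul_linear_l IHx IHy scalerDr addrACA.
apply: zin_ind => [k x y IHx IHy c|w t].
  rewrite !(zin_mul_linear_l, zin_mul_linear_r) IHx IHy.
  by rewrite scalerDr addrACA.
apply: zin_ind => [k x y IHx IHy|z u].
  rewrite !(zin_mul_linear_l, zin_mul_linear_r) IHx IHy.
  by rewrite scalerDr addrACA.
pose phi := @word F V \o cons v.
have mulE r x p : zin_mul (word (v :: r)) (word (x :: p)) = shuffle_sum phi r (x :: p).
  exact: zin_mul_word.
rewrite (zin_mul_word w t z u) (zin_mul_word z u w t) (zin_mul_word v s w t).
rewrite !zin_mul_sumr zin_mul_suml.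
transitivity (shuffle_sum (fun r => shuffle_sum phi r (z :: u)) s (w :: t)).
  by apply: eq_bigr => r _; rewrite mulE.
rewrite shuffle_sumA shuffle_sum_cons (shuffle_sumC _ (w :: t)).
by congr (_ + _); apply: eq_bigr => r _; rewrite mulE.
Qed.
End ProductTheory.

(** * The monad structure *)

Section Maps.
Variables (F : fieldType).
Implicit Types (V W : lmodType F).

Definition zin_map V W (f : {linear V -> W}) : Zin V -> Zin W :=
  zin_lift (fun s => word (map f s)).

Fact zin_map_linear V W (f : {linear V -> W}) : linear (zin_map f).
Proof. exact/zin_lift_linear/multilinear_comp/word_multilinear. Qed.

HB.instance Definition _ V W (f : {linear V -> W}) :=
  GRing.isLinear.Build F (Zin V) (Zin W) *:%R (zin_map f) (zin_map_linear f).

Lemma zin_mapE V W (f : {linear V -> W}) v s :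
  zin_map f (word (v :: s)) = word (map f (v :: s)).
Proof. exact/zin_liftE/multilinear_comp/word_multilinear. Qed.

Definition zin_unit V (v : V) : Zin V := word [:: v].

Fact zin_unit_linear V : linear (@zin_unit V).
Proof. by move=> a x y; apply: (word_multilinear a x y [::] [::]). Qed.

HB.instance Definition _ V :=
  GRing.isLinear.Build F V (Zin V) *:%R (@zin_unit V) (@zin_unit_linear V).

Fixpoint zin_nest V (s : seq (Zin V)) : Zin V :=
  if s is x :: s' then
    if s' is [::] then x else zin_mul x (zin_nest s')
  else 0.

Lemma zin_nest_cons V x y (s : seq (Zin V)) :
  zin_nest (x :: y :: s) = zin_mul x (zin_nest (y :: s)).
Proof. by []. Qed.

Lemma zin_nest_multilinear V : multilinear (@zin_nest V).
Proof.
move=> a x y s t; elim: s => [|z s IHs].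
  by case: t => [|w t] //; rewrite ![_ ++ _]/= !zin_nest_cons zin_mul_linear_l.
have E w : zin_nest ((z :: s) ++ w :: t) = zin_mul z (zin_nest (s ++ w :: t)).
  by case: (s).
by rewrite !E IHs zin_mul_linear_r.
Qed.

Definition zin_mult V : Zin (Zin V) -> Zin V := zin_lift (@zin_nest V).

Fact zin_mult_linear V : linear (@zin_mult V).
Proof. exact/zin_lift_linear/zin_nest_multilinear. Qed.

HB.instance Definition _ V :=
  GRing.isLinear.Build F (Zin (Zin V)) (Zin V) *:%R (@zin_mult V)
    (@zin_mult_linear V).

Lemma zin_multE V x (s : seq (Zin V)) :
  zin_mult (word (x :: s)) = zin_nest (x :: s).
Proof. exact/zin_liftE/zin_nest_multilinear. Qed.

Lemma shuffle_map (T U : Type) (f : T -> U) s t :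
  shuffle (map f s) (map f t) = map (map f) (shuffle s t).
Proof.
elim: s t => [|x s IHs] // t.
elim: t => [|y t IHt] //=.
rewrite map_cat -!map_comp; congr (_ ++ _).
  by rewrite -[f y :: map f t]/(map f (y :: t)) IHs -map_comp.
by move: IHt => /= ->; rewrite -map_comp.
Qed.

Lemma zin_map_mul V W (f : {linear V -> W}) a b :
  zin_map f (zin_mul a b) = zin_mul (zin_map f a) (zin_map f b).
Proof.
move: a b; apply: zin_ind => [k x y IHx IHy b|v s].
  by rewrite zin_mul_linear_l !zin_map_linear IHx IHy zin_mul_linear_l.
apply: zin_ind => [k x y IHx IHy|w t].
  by rewrite zin_mul_linear_r !zin_map_linear IHx IHy zin_mul_linear_r.
rewrite !zin_mapE zin_mul_word (linear_sum (zin_map f)) /= zin_mul_word.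
rewrite -map_cons shuffle_map big_map.
by apply: eq_bigr => r _; rewrite zin_mapE.
Qed.

Lemma zin_map_nest V W (f : {linear V -> W}) s :
  zin_map f (zin_nest s) = zin_nest (map (zin_map f) s).
Proof.
elim: s => [|x [|y s] IHs] //; first exact: linear0.
by rewrite zin_nest_cons zin_map_mul IHs.
Qed.

Lemma zin_nest_shuffle V x (s : seq (Zin V)) y t :
  \sum_(r <- shuffle s (y :: t)) zin_nest (x :: r) =
  zin_mul (zin_nest (x :: s)) (zin_nest (y :: t)).
Proof.
have [n] := ubnP (size s + size t); elim: n => // n IHn in x s y t *.
case: s => [|z s] lt_n; first by rewrite /= big_seq1.
have -> : \sum_(r <- shuffle (z :: s) (y :: t)) zin_nest (x :: r) =
    zin_mul x (\sum_(r <- shuffle s (y :: t)) zin_nest (z :: r))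
    + zin_mul x (\sum_(r <- shuffle t (z :: s)) zin_nest (y :: r)).
  rewrite -[\sum_(r <- shuffle t _) _](@shuffle_sumC F _ _ (@zin_nest V \o cons y)).
  by rewrite !zin_mul_sumr /= big_cat !big_map.
rewrite !IHn; first by rewrite zin_nest_cons zin_mulA.
  by rewrite addnC -ltnS (leq_trans _ lt_n) //= addSn.
by move: lt_n => /=; rewrite addSn ltnS.
Qed.

Lemma zin_mult_mul V (a b : Zin (Zin V)) :
  zin_mult (zin_mul a b) = zin_mul (zin_mult a) (zin_mult b).
Proof.
move: a b; apply: zin_ind => [k x y IHx IHy b|v s].
  rewrite (zin_mul_linear_l b k x y) !(linearP (@zin_mult V)) /= IHx IHy.
  by rewrite (zin_mul_linear_l (zin_mult b) k).
apply: zin_ind => [k x y IHx IHy|w t].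
  rewrite (zin_mul_linear_r (word (v :: s)) k x y) !(linearP (@zin_mult V)) /= IHx IHy.
  by rewrite (zin_mul_linear_r (zin_mult (word (v :: s))) k).
rewrite (zin_mul_word v s w t) (linear_sum (@zin_mult V)) /= !zin_multE.
by rewrite -zin_nest_shuffle; apply: eq_bigr => r _; rewrite zin_multE.
Qed.

Lemma zin_mult_nest V (s : seq (Zin (Zin V))) : zin_mult (zin_nest s) = zin_nest (map (@zin_mult V) s).
Proof.
elim: s => [|x [|y s] IHs] //; first exact: linear0.
by rewrite zin_nest_cons zin_mult_mul IHs.
Qed.

Lemma zin_nest_unit V v (s : seq V) :
  zin_nest (map (@zin_unit V) (v :: s)) = word (v :: s).
Proof.
elim: s v => [|w s IHs] v //.
rewrite !map_cons zin_nest_cons -map_cons IHs.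
rewrite -[zin_unit v]/(word [:: v]) zin_mul_word.
by rewrite [shuffle _ _]/= big_seq1.
Qed.
End Maps.


Section Monad.
Variable F : fieldType.
Implicit Types U V W : lmodType F.

(* Monads on the category of F-vector spaces and linear maps; equality of
   morphisms is pointwise equality. *)
Record monad := Monad {
  tobj :> lmodType F -> lmodType F;
  tmap : forall V W, {linear V -> W} -> {linear tobj V -> tobj W};
  tmult : forall V, {linear tobj (tobj V) -> tobj V};
  tunit : forall V, {linear V -> tobj V};
  tmap_id : forall V, tmap (idfun : {linear V -> V}) =1 idfun;
  tmap_comp : forall U V W (g : {linear V -> W}) (f : {linear U -> V}),
    tmap (g \o f : {linear U -> W}) =1 tmap g \o tmap f;
  tunit_nat : forall V W (f : {linear V -> W}),
    tmap f \o tunit V =1 tunit W \o f;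
  tmult_nat : forall V W (f : {linear V -> W}),
    tmap f \o tmult V =1 tmult W \o tmap (tmap f);
  tmultA : forall V, tmult V \o tmap (tmult V) =1 tmult V \o tmult (tobj V);
  tmult_unit : forall V, tmult V \o tunit (tobj V) =1 idfun;
  tmult_map_unit : forall V, tmult V \o tmap (tunit V) =1 idfun
}.
End Monad.

Section ZinMonad.
Variable F : fieldType.
Implicit Types U V W : lmodType F.

Fact zin_map_id V : zin_map (idfun : {linear V -> V}) =1 idfun.
Proof.
apply: (@zin_ext _ _ _ (zin_map _)%FUN (idfun)%FUN) => v s.
by rewrite /= zin_mapE map_id.
Qed.

Fact zin_map_comp U V W (g : {linear V -> W}) (f : {linear U -> V}) :
  zin_map (g \o f : {linear U -> W}) =1 zin_map g \o zin_map f.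
Proof.
apply: (@zin_ext _ _ _ (zin_map _)%FUN (zin_map g \o zin_map f)%FUN) => v s.
by rewrite /= !zin_mapE map_comp.
Qed.

Fact zin_unit_nat V W (f : {linear V -> W}) :
  zin_map f \o @zin_unit F V =1 @zin_unit F W \o f.
Proof. by move=> v; rewrite /= zin_mapE. Qed.

Fact zin_mult_nat V W (f : {linear V -> W}) :
  zin_map f \o @zin_mult F V =1 @zin_mult F W \o zin_map (zin_map f).
Proof.
apply: (@zin_ext _ _ _ (zin_map f \o @zin_mult F V)%FUN (@zin_mult F W \o zin_map (zin_map f))%FUN) => v s /=.
by rewrite zin_multE zin_mapE zin_multE zin_map_nest.
Qed.

Fact zin_multA V : @zin_mult F V \o zin_map (@zin_mult F V) =1 @zin_mult F V \o @zin_mult F (Zin V).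
Proof.
apply: (@zin_ext _ _ _ (@zin_mult F V \o zin_map (@zin_mult F V))%FUN (@zin_mult F V \o @zin_mult F (Zin V))%FUN) => v s /=.
by rewrite zin_mapE !zin_multE zin_mult_nest.
Qed.

Fact zin_mult_unit V : @zin_mult F V \o @zin_unit F (Zin V) =1 idfun.
Proof. by move=> x; rewrite /= zin_multE. Qed.

Fact zin_mult_map_unit V : @zin_mult F V \o zin_map (@zin_unit F V) =1 idfun.
Proof.
apply: (@zin_ext _ _ _ (@zin_mult F V \o zin_map (@zin_unit F V))%FUN (idfun)%FUN) => v s /=.
by rewrite zin_mapE zin_multE zin_nest_unit.
Qed.

Definition zin_monad : monad F :=
  @Monad F (@Zin F) (fun V W f => zin_map f) (fun V => @zin_mult F V)
    (fun V => @zin_unit F V) zin_map_id zin_map_comp zin_unit_nat zin_mult_nat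
    zin_multA zin_mult_unit zin_mult_map_unit.
End ZinMonad.

(** * Biproducts of vector spaces *)

Section Biproduct.
Variable F : fieldType.
Implicit Types U V W : lmodType F.

Definition pairing U V W (f : {linear U -> V}) (g : {linear U -> W}) (u : U) :
  V * W := (f u, g u).

Fact pairing_linear U V W (f : {linear U -> V}) (g : {linear U -> W}) :
  linear (pairing f g).
Proof. by move=> a x y; rewrite /pairing !linearP. Qed.

HB.instance Definition _ U V W (f : {linear U -> V}) (g : {linear U -> W}) :=
  GRing.isLinear.Build F U (V * W)%type *:%R (pairing f g) (pairing_linear f g).

Definition copairing U V W (f : {linear U -> W}) (g : {linear V -> W})
  (p : U * V) : W := f p.1 + g p.2.

Fact copairing_linear U V W (f : {linear U -> W}) (g : {linear V -> W}) :
  linear (copairing f g).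
Proof.
by move=> a x y; rewrite /copairing /= !linearP scalerDr addrACA.
Qed.

HB.instance Definition _ U V W (f : {linear U -> W}) (g : {linear V -> W}) :=
  GRing.isLinear.Build F (U * V)%type W *:%R (copairing f g)
    (copairing_linear f g).

Definition proj0 V W : {linear (V * W)%type -> V} := fst.
Definition proj1 V W : {linear (V * W)%type -> W} := snd.
Definition inj0 V W : {linear V -> (V * W)%type} := pairing idfun \0.
Definition inj1 V W : {linear W -> (V * W)%type} := pairing \0 idfun.
Definition diag V : {linear V -> (V * V)%type} := pairing idfun idfun.

Definition prodmap U V U' V' (f : {linear U -> U'}) (g : {linear V -> V'}) :
    {linear (U * V)%type -> (U' * V')%type} :=
  pairing (f \o proj0 U V)%FUN (g \o proj1 U V)%FUN.

Definition interchange V :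
    {linear ((V * V) * (V * V))%type -> ((V * V) * (V * V))%type} :=
  pairing (prodmap (proj0 V V) (proj0 V V)) (prodmap (proj1 V V) (proj1 V V)).
End Biproduct.

(** * Differential combinator transformations *)

Record differential_combinator (F : fieldType) (S : monad F)
    (d : forall V : lmodType F, {linear S V -> S (V * V)%type}) : Prop := {
  dc_nat : forall (V W : lmodType F) (f : {linear V -> W}),
    tmap S (prodmap f f) \o d V =1 d W \o tmap S f;
  dc1 : forall V, tmap S (proj0 V V) \o d V =1 \0;
  dc2 : forall V,
    tmap S (prodmap idfun (diag V)) \o d V =1
    (tmap S (prodmap idfun (inj0 V V)) \+ tmap S (prodmap idfun (inj1 V V)))
      \o d V;
  dc3 : forall V, d V \o tunit S V =1 tunit S (V * V)%type \o inj1 V V;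
  dc4 : forall V,
    d V \o tmult S V =1
    tmult S (V * V)%type \o tmap S (copairing (tmap S (inj0 V V)) (d V))
      \o d (S V);
  dc5 : forall V,
    tmap S (prodmap (proj0 V V) (proj1 V V)) \o d (V * V)%type \o d V =1 d V;
  dc6 : forall V,
    tmap S (interchange V) \o d (V * V)%type \o d V =1 d (V * V)%type \o d V
}.

(* Main.v *)
From HB Require Import structures.
Require Import Defs.
From mathcomp Require Import all_boot all_algebra.

(** The transformation [d] marks the first letter of a word: it sends the first
    letter through [inj1 V V] and all the others through [inj0 V V].  Every
    axiom is an equality of linear maps, so it can be tested on words.  Apart
    from the axiom on the multiplication of the monad, both sides are then
    words (or sums of two words) whose letters are explicit, and it is enough
    to compare letters.  The vanishing and additivity axioms are instances of
    the linearity of a word in its first letter ([word0], [wordD]).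

    The multiplication axiom is where the Zinbiel product enters.  All words of
    a product [a < b] begin with the first letter of [a], so marking the first
    letter of [a < b] marks that of [a] and merely includes [b]:
    [d (a < b) = d a < Zin (inj0 V V) b] ([zin_diff_mul]).  An iterated product
    [x < (y1 < (... < yn))] therefore only has its outermost left factor
    differentiated, which is also what one gets by marking the first letter of
    the word with letters [x], [y1], ..., [yn] in [Zin V] and then evaluating
    it through the copairing. *)

Local Open Scope ring_scope.
Import GRing.Theory.

Section Differential.
Variable F : fieldType.
Implicit Types V W : lmodType F.

Lemma wordD V (x y : V) (s : seq V) :
  word ((x + y) :: s) = word (x :: s) + word (y :: s).
Proof.
by have := word_multilinear 1 x y [::] s; rewrite /= !scale1r.
Qed.

Lemma word0 V (s : seq V) : word (0 :: s) = 0.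
Proof.
have := word_multilinear (-1) (0 : V) 0 [::] s.
by rewrite /= scaler0 addr0 scaleN1r addNr.
Qed.

(** Multilinearity in the letters depends only on [f] and [g] being linear, so
    the two injections are replaced by arbitrary linear maps. *)
Definition mark_first V W (f g : {linear V -> W}) (s : seq V) : Zin W :=
  if s is v :: s' then word (f v :: map g s') else 0.

Lemma mark_first_multilinear V W (f g : {linear V -> W}) :
  multilinear (mark_first V W f g).
Proof.
move=> a x y [|v s] t /=.
  by rewrite linearP; apply: (word_multilinear _ _ _ [::]).
exact: (multilinear_comp g (word_consM (f v)) a x y s t).
Qed.

Definition zin_diff V : Zin V -> Zin (V * V)%type :=
  zin_lift (mark_first _ _ (inj1 V V) (inj0 V V)).

Fact zin_diff_linear V : linear (zin_diff V).
Proof. exact/zin_lift_linear/mark_first_multilinear. Qed.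

HB.instance Definition _ V :=
  GRing.isLinear.Build F (Zin V) (Zin (V * V)%type) *:%R (zin_diff V)
    (zin_diff_linear V).

Lemma zin_diffE V v (s : seq V) :
  zin_diff V (word (v :: s)) = word ((0, v) :: [seq (w, 0) | w <- s]).
Proof. exact/zin_liftE/mark_first_multilinear. Qed.

(** Every word of [zin_mul a b] starts with the first letter of [a], which no
    shuffle moves; the letters being shuffled are all included by [inj0 V V],
    and inclusion commutes with shuffling. *)
Lemma zin_diff_mul V (a b : Zin V) :
  zin_diff V (zin_mul a b) = zin_mul (zin_diff V a) (zin_map (inj0 V V) b).
Proof.
move: a b; apply: zin_ind => [k x y IHx IHy b|v s].
  by rewrite zin_mul_linear_l !zin_diff_linear IHx IHy zin_mul_linear_l.
apply: zin_ind => [k x y IHx IHy|w t].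
  rewrite zin_mul_linear_r zin_diff_linear IHx IHy.
  by rewrite zin_map_linear zin_mul_linear_r.
rewrite zin_mul_word (linear_sum (zin_diff V)) /= zin_diffE zin_mapE.
rewrite zin_mul_word -map_cons shuffle_map big_map.
by apply: eq_bigr => r _; rewrite zin_diffE.
Qed.

(** The product is nested to the right, so [x] is the left factor of the
    outermost product and [zin_diff_mul] need be applied only once. *)
Lemma zin_diff_nest V x (s : seq (Zin V)) :
  zin_diff V (zin_nest (x :: s)) =
  zin_nest (zin_diff V x :: map (zin_map (inj0 V V)) s).
Proof.
case: s => [|y s] //.
by rewrite zin_nest_cons zin_diff_mul zin_map_nest.
Qed.

Lemma zin_diff_mult V (x : Zin (Zin V)) :
  zin_diff V (zin_mult x) =
  zin_mult (zin_map (copairing (zin_map (inj0 V V)) (zin_diff V))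
    (zin_diff (Zin V) x)).
Proof.
move: x; apply: (zin_ext (f := zin_diff V \o @zin_mult F V)
  (g := @zin_mult F (V * V)%type
          \o zin_map (copairing (zin_map (inj0 V V)) (zin_diff V))
          \o zin_diff (Zin V))) => v s /=.
rewrite zin_multE zin_diffE zin_mapE zin_multE zin_diff_nest /=.
(* The first letter [(0, v)] only sees the second component of the copairing,
   the other letters [(w, 0)] only the first. *)
congr (zin_nest (_ :: _)); first by rewrite /copairing /= linear0 add0r.
by rewrite -[RHS]map_comp; apply: eq_map => w; rewrite /copairing /= linear0 addr0.
Qed.
End Differential.

Theorem proposition7p4 (F : fieldType) :
  exists d : forall V : lmodType F, {linear Zin V -> Zin (V * V)%type},
    (forall (V : lmodType F) (v : V) (s : seq V),
       d V (word (v :: s)) = word ((0, v) :: [seq (w, 0) | w <- s]))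
    /\ differential_combinator (S := zin_monad F) d.
Proof.
exists (fun V => @zin_diff F V); split; first exact: zin_diffE.
split=> /=.
- move=> V W f.
  apply: (zin_ext (f := zin_map (prodmap f f) \o zin_diff F V)
                  (g := zin_diff F W \o zin_map f)) => v s /=.
  rewrite zin_diffE !zin_mapE zin_diffE /=.
  congr (word (_ :: _)); first by rewrite /pairing /= linear0.
  rewrite -[LHS]map_comp -[RHS]map_comp; apply: eq_map => w.
  by rewrite /= /pairing /= linear0.
- move=> V.
  apply: (zin_ext (f := zin_map (proj0 V V) \o zin_diff F V) (g := \0)) => v s.
  by rewrite /= zin_diffE zin_mapE /= word0.
- move=> V.
  apply: (zin_ext (f := zin_map (prodmap idfun (diag V)) \o zin_diff F V)
    (g := (zin_map (prodmap idfun (inj0 V V))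
           \+ zin_map (prodmap idfun (inj1 V V))) \o zin_diff F V)) => v s /=.
  rewrite zin_diffE !zin_mapE /=.
  have mapE (h : {linear V -> (V * V)%type}) :
      [seq prodmap idfun h i | i <- [seq (w, 0) | w <- s]]
      = [seq (w, 0) | w <- s].
    rewrite -[LHS]map_comp; apply: eq_map => w.
    by rewrite /= /pairing /= linear0.
  (* Only the first letter differs between the three words, and there
     (0, (v, v)) = (0, (v, 0)) + (0, (0, v)). *)
  rewrite !mapE -wordD /pairing /=.
  by congr (word (_ :: _)); congr pair;
    rewrite ?addr0 //; congr pair; rewrite ?addr0 ?add0r.
- by move=> V v; apply: zin_diffE.
- by move=> V x; apply: zin_diff_mult.
- move=> V.
  apply: (zin_ext (f := zin_map (prodmap (proj0 V V) (proj1 V V))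
                        \o zin_diff F (V * V)%type \o zin_diff F V)
                  (g := zin_diff F V)) => v s /=.
  rewrite !zin_diffE zin_mapE /=; congr (word (_ :: _)).
  by rewrite -![LHS]map_comp; apply: eq_map.
- move=> V.
  apply: (zin_ext (f := zin_map (Defs.interchange V)
                        \o zin_diff F (V * V)%type \o zin_diff F V)
                  (g := zin_diff F (V * V)%type \o zin_diff F V)) => v s /=.
  rewrite !zin_diffE zin_mapE /=; congr (word (_ :: _)).
  by rewrite -![LHS]map_comp -[RHS]map_comp; apply: eq_map.
Qed.
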